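(* Let $R=(r_1,\ldots,r_m)$, $C=(c_1,\ldots,c_n)$ be vectors of positive integers with $\sum_ir_i=\sum_jc_j$, $0<r_i<n$, $0<c_j<m$, such that the polytope $\mathcal{P}(R,C)$ of real $m\times n$ matrices with row sums $R$, column sums $C$ and entries in $[0,1]$ contains a matrix with all entries strictly between $0$ and $1$. Let $Z=(z_{ij})$ be the maximum entropy matrix, i.e., the unique maximizer on $\mathcal{P}(R,C)$ of $H(X)=\sum_{i,j}\big(x_{ij}\ln\frac1{x_{ij}}+(1-x_{ij})\ln\frac1{1-x_{ij}}\big)$. Let $X=(x_{ij})$ be a random $m\times n$ matrix of independent Bernoulli random variables with $\Pr\{x_{ij}=1\}=z_{ij}$ and $\Pr\{x_{ij}=0\}=1-z_{ij}$. Then the probability mass function of $X$ is constant on the set $\Sigma(R,C)$ of $m\times n$ 0-1 matrices with row sums $R$ and column sums $C$; moreover $\Pr\{X=D\}=e^{-H(Z)}$ for all $D\in\Sigma(R,C)$.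
   Context: The convention $0\ln\frac10=0$ is used in $H$. *)

(* Defs.v *)
From HB Require Import structures.
From mathcomp Require Export all_boot all_order all_algebra.
From mathcomp Require Export all_classical all_reals all_analysis.

Set Implicit Arguments.
Unset Strict Implicit.
Unset Printing Implicit Defensive.

Import Order.TTheory GRing.Theory Num.Theory.

Local Open Scope classical_set_scope.
Local Open Scope ring_scope.

Section Matrices.
Context {R : realType} {m n : nat}.

Definition margins (r : 'I_m -> nat) (c : 'I_n -> nat) (X : 'M[R]_(m, n)) : Prop :=
  (forall i, \sum_(j < n) X i j = (r i)%:R) /\
  (forall j, \sum_(i < m) X i j = (c j)%:R).

Definition polytope (r : 'I_m -> nat) (c : 'I_n -> nat) : set 'M[R]_(m, n) :=
  [set X | margins r c X /\ forall i j, 0 <= X i j <= 1].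

Definition zero_one_matrices (r : 'I_m -> nat) (c : 'I_n -> nat) :
    set 'M[R]_(m, n) :=
  [set D | margins r c D /\ forall i j, D i j = 0 \/ D i j = 1].

(* The convention 0 ln (1/0) = 0 holds because the factor in front of ln is 0
   and ln is total. *)
Definition entropy (X : 'M[R]_(m, n)) : R :=
  \sum_(i < m) \sum_(j < n)
    (X i j * ln (1 / X i j) + (1 - X i j) * ln (1 / (1 - X i j))).

(* Uniqueness of the maximizer is a consequence of the strict concavity of the
   entropy, so it is not part of the definition. *)
Definition max_entropy_matrix (r : 'I_m -> nat) (c : 'I_n -> nat)
    (Z : 'M[R]_(m, n)) : Prop :=
  polytope r c Z /\ forall Y, polytope r c Y -> entropy Y <= entropy Z.

End Matrices.

Section Probability.
Context {d : measure_display} {T : measurableType d} {R : realType}.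

Definition mutually_independent (P : probability T R) (I : finType)
    (X : I -> {RV P >-> R}) : Prop :=
  forall (J : {set I}) (B : I -> set R),
    (forall i, i \in J -> measurable (B i)) ->
    P (\bigcap_(i in [set` J]) (X i @^-1` B i)) =
    (\prod_(i in J) P (X i @^-1` B i))%E.

Definition random_matrix (P : probability T R) (m n : nat)
    (X : 'I_m -> 'I_n -> {RV P >-> R}) (w : T) : 'M[R]_(m, n) :=
  \matrix_(i, j) X i j w.

Definition matrix_pmf (P : probability T R) (m n : nat)
    (X : 'I_m -> 'I_n -> {RV P >-> R}) (D : 'M[R]_(m, n)) : \bar R :=
  P [set w | random_matrix X w = D].

End Probability.

(* Main.v *)
(** Let [A] be an affine set of families of reals and [z] a maximizer of the
    entropy over [A] and the unit cube.  A family of independent Bernoulli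
    variables with means [z] takes a 0-1 value [x] with probability
    [expR (- cross_entropy x z)].  Now [cross_entropy ^~ z] is affine, equals the
    entropy at [z], and is tangent there to the entropy; since the entropy is
    stationary at [z] along [A], the cross-entropy is constant on [A], equal to
    the entropy of [z].

    Stationarity requires [z] to be interior to the cube.  It is, as soon as [A]
    has an interior point [y]: moving from [z] towards [y], the slope of the
    entropy would be infinite at the coordinates where [z] is 0 or 1, and it is
    bounded below at all others. *)
Require Import Defs.
From mathcomp Require Import ring lra.
Set Implicit Arguments.
Unset Strict Implicit.
Unset Printing Implicit Defensive.
Import Order.TTheory GRing.Theory Num.Theory.
Import numFieldNormedType.Exports.
Local Open Scope classical_set_scope.
Local Open Scope ring_scope.

Section LinePath.
Context {R : realType}.
Implicit Types a b t : R.

Lemma is_derive_line_path a b t : is_derive t 1 (line_path a b) (b - a).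
Proof.
rewrite /line_path; apply: is_derive_eq.
by rewrite /GRing.scale /=; ring.
Qed.

Lemma continuous_line_path a b : continuous (line_path a b).
Proof.
move=> t; apply/differentiable_continuous/derivable1_diffP.
by have [] := is_derive_line_path a b t.
Qed.

End LinePath.

Section BinaryEntropy.
Context {R : realType}.
Implicit Types t x y z : R.

Definition binary_cross_entropy x z : R := - (x * ln z + (1 - x) * ln (1 - z)).

Definition binary_entropy x : R := binary_cross_entropy x x.

Definition log_odds x : R := ln x - ln (1 - x).

Lemma ln_inv x : ln x^-1 = - ln x.
Proof.
have [x0|x0] := ltP 0 x; first by rewrite lnV.
by rewrite !ln0 ?oppr0 // invr_le0.
Qed.

Lemma mulr_lnB_le x z : 0 <= x -> 0 < z -> x * (ln z - ln x) <= z - x.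
Proof.
rewrite le_eqVlt => /predU1P[<- /ltW|x0 z0]; first by rewrite mul0r subr0.
have -> : z - x = x * (z / x - 1) by field; rewrite gt_eqF.
rewrite ler_pM2l // -ln_div ?posrE // -[in leLHS](subrKC 1 (z / x)) le_ln1Dx //.
by rewrite ltrBrDr addNr divr_gt0.
Qed.

Lemma binary_entropy_le_cross_entropy x z : 0 <= x <= 1 -> 0 < z < 1 ->
  binary_entropy x <= binary_cross_entropy x z.
Proof.
move=> /andP[x0 x1] /andP[z0 z1].
have gibbs1 := mulr_lnB_le x0 z0.
have gibbs0 : (1 - x) * (ln (1 - z) - ln (1 - x)) <= (1 - z) - (1 - x).
  by apply: mulr_lnB_le; rewrite ?subr_ge0 ?subr_gt0.
by rewrite /binary_entropy /binary_cross_entropy; lra.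
Qed.

Lemma binary_cross_entropyE x z :
  binary_cross_entropy x z = binary_entropy z - (x - z) * log_odds z.
Proof. by rewrite /binary_entropy /binary_cross_entropy /log_odds; ring. Qed.

Lemma expRN_binary_cross_entropy0 z : z < 1 ->
  expR (- binary_cross_entropy 0 z) = 1 - z.
Proof.
by move=> z1; rewrite opprK mul0r add0r subr0 mul1r lnK // posrE subr_gt0.
Qed.

Lemma expRN_binary_cross_entropy1 z : 0 < z ->
  expR (- binary_cross_entropy 1 z) = z.
Proof. by move=> z0; rewrite opprK mul1r subrr mul0r addr0 lnK. Qed.

Lemma is_derive_binary_entropy x : 0 < x < 1 ->
  is_derive x 1 binary_entropy (- log_odds x).
Proof.
move=> /andP[x0 x1].
have dln := is_derive1_ln x0.
have dlnB : is_derive (1 - x) 1 (@ln R) (1 - x)^-1.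
  by apply: is_derive1_ln; rewrite subr_gt0.
rewrite /binary_entropy /binary_cross_entropy; apply: is_derive_eq.
rewrite /GRing.scale /= /log_odds.
by field; rewrite !gt_eqF ?subr_gt0.
Qed.

Lemma log_odds_onem x : log_odds (1 - x) = - log_odds x.
Proof. by rewrite /log_odds subKr opprB. Qed.

Lemma le_log_odds x y : 0 < x -> x <= y -> y < 1 -> log_odds x <= log_odds y.
Proof. by move=> x0 xy y1; rewrite /log_odds lerB // ler_ln ?posrE; lra. Qed.

Lemma log_odds_line_path_le z y t : 0 <= z <= 1 -> 0 < y < 1 -> 0 < t <= 1 ->
  (y - z) * log_odds (line_path z y t) <= (y - z) * log_odds y.
Proof.
rewrite /line_path => z01 y01 t01; have [zy|yz] := leP z y.
- by apply: ler_wpM2l; [lra|apply: le_log_odds; nra].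
- by rewrite ler_nM2l ?subr_lt0 //; apply: le_log_odds; nra.
Qed.

Lemma log_odds_mul_le y t : 0 < y < 1 -> 0 < t <= 1 ->
  log_odds (t * y) <= log_odds y + ln t.
Proof.
move=> /andP[y0 y1] /andP[t0 t1].
rewrite /log_odds lnM ?posrE // [ln t + _]addrC addrAC lerD2r lerD2l lerN2.
by rewrite ler_ln ?posrE; nra.
Qed.

(* The summand [ln t] tends to [-oo] as [t] tends to 0. *)
Lemma log_odds_line_path_le_ln z y t : z = 0 \/ z = 1 -> 0 < y < 1 -> 0 < t <= 1 ->
  (y - z) * log_odds (line_path z y t) <= (y - z) * log_odds y + `|y - z| * ln t.
Proof.
rewrite /line_path => -[->|->] y01 t01; have /andP[y0 y1] := y01.
- rewrite mulr0 add0r subr0 gtr0_norm // -mulrDr ler_pM2l //.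
  exact: log_odds_mul_le.
- have -> : (1 - t) * 1 + t * y = 1 - t * (1 - y) by ring.
  have y01C : 0 < 1 - y < 1 by lra.
  have := log_odds_mul_le y01C t01.
  rewrite !log_odds_onem distrC gtr0_norm ?subr_gt0 // => log_odds_le.
  by nra.
Qed.

End BinaryEntropy.

Section MaximumEntropy.
Context {R : realType} {I : finType}.
Implicit Types (A : set (I -> R)) (x y z : I -> R).

Definition cross_entropy x z : R := \sum_i binary_cross_entropy (x i) (z i).

Definition family_entropy x : R := \sum_i binary_entropy (x i).

Definition unit_cube : set (I -> R) := [set x | forall i, 0 <= x i <= 1].

Definition open_unit_cube : set (I -> R) := [set x | forall i, 0 < x i < 1].

Definition line_through x y (t : R) : I -> R := fun i => line_path (x i) (y i) t.

Definition affine_set A : Prop :=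
  forall x y t, A x -> A y -> A (line_through x y t).

Definition max_entropy_point A z : Prop :=
  (A `&` unit_cube) z /\
  forall x, (A `&` unit_cube) x -> family_entropy x <= family_entropy z.

Lemma open_unit_cubeW : open_unit_cube `<=` unit_cube.
Proof. by move=> x x01 i; have /andP[/ltW -> /ltW ->] := x01 i. Qed.

Lemma family_entropy_le_cross_entropy x z : unit_cube x -> open_unit_cube z ->
  family_entropy x <= cross_entropy x z.
Proof.
by move=> x01 z01; apply: ler_sum => i _; exact: binary_entropy_le_cross_entropy.
Qed.

Lemma cross_entropyE x z :
  cross_entropy x z = family_entropy z - \sum_i (x i - z i) * log_odds (z i).
Proof. by rewrite -sumrB; apply: eq_bigr => i _; exact: binary_cross_entropyE. Qed.

Lemma max_entropy_line_le A z y t : affine_set A -> max_entropy_point A z ->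
    A y -> open_unit_cube (line_through z y t) ->
  family_entropy (line_through z y t) <= family_entropy z.
Proof.
move=> affA [[Az _] zmax] Ay /open_unit_cubeW zy01.
by apply: zmax; split=> //; exact: affA.
Qed.

Lemma max_entropy_log_odds_ge0 A z y t : affine_set A -> max_entropy_point A z ->
    A y -> 0 < t -> open_unit_cube (line_through z y t) ->
  0 <= \sum_i (y i - z i) * log_odds (line_through z y t i).
Proof.
move=> affA zmax Ay t0 zy01; have [[_ z01] _] := zmax.
have := le_trans (max_entropy_line_le affA zmax Ay zy01)
                 (family_entropy_le_cross_entropy z01 zy01).
rewrite cross_entropyE lerDl -sumrN => slope_ge0.
rewrite -(pmulr_rge0 _ t0) mulr_sumr; congr (0 <= _): slope_ge0.
by apply: eq_bigr => i _; rewrite /line_through line_pathEl; ring.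
Qed.

Lemma max_entropy_interior A z y : affine_set A -> max_entropy_point A z ->
  A y -> open_unit_cube y -> open_unit_cube z.
Proof.
move=> affA zmax Ay y01 k; have [[_ z01] _] := zmax.
apply: contrapT => /negP zk.
have zk01 : z k = 0 \/ z k = 1.
  move: zk (z01 k); rewrite negb_and -!leNgt => /orP[] ? /andP[? ?];
    [left|right]; by apply/le_anti/andP.
have yz_gt0 : 0 < `|y k - z k|.
  have /andP[yk0 yk1] := y01 k; rewrite normr_gt0 subr_eq0.
  by case: zk01 => ->; [rewrite gt_eqF|rewrite lt_eqF].
pose S := \sum_i (y i - z i) * log_odds (y i).
pose t := expR (- ((`|S| + 1) / `|y k - z k|)).
have t01 : 0 < t <= 1.
  by rewrite expR_gt0 -[leRHS]expR0 ler_expR oppr_le0 divr_ge0 // addr_ge0.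
have ln_t : `|y k - z k| * ln t = - (`|S| + 1).
  by rewrite expRK mulrN mulrC divfK ?gt_eqF.
have zy01 : open_unit_cube (line_through z y t).
  by move=> i; move: (y01 i) (z01 i); rewrite /line_through /line_path; nra.
have sum_le : \sum_i (y i - z i) * log_odds (line_through z y t i) <=
    S + `|y k - z k| * ln t.
  rewrite /S (bigD1 k) //= [in leRHS](bigD1 k) //= addrAC.
  apply: lerD; first exact: log_odds_line_path_le_ln.
  by apply: ler_sum => i _; exact: log_odds_line_path_le.
have := max_entropy_log_odds_ge0 affA zmax Ay (andP t01).1 zy01.
apply/negP; rewrite -ltNge (le_lt_trans sum_le) // ln_t subr_lt0.
by rewrite (le_lt_trans (ler_norm S)) // ltrDl.
Qed.

Lemma is_derive_family_entropy_line z y t : open_unit_cube (line_through z y t) ->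
  is_derive t 1 (family_entropy \o line_through z y)
    (- \sum_i (y i - z i) * log_odds (line_through z y t i)).
Proof.
move=> zy01; rewrite -sumrN.
have -> : family_entropy \o line_through z y =
    \sum_i (binary_entropy \o line_path (z i) (y i)).
  by apply/funext => s; rewrite fct_sumE.
elim/big_ind2: _ => [|f df g dg f_df g_dg|i _].
- exact: is_derive_cst.
- exact: is_deriveD.
- rewrite -mulrN mulrC.
  apply: (@is_derive1_comp _ _ (line_path (z i) (y i))).
    exact: is_derive_binary_entropy (zy01 i).
  exact: is_derive_line_path.
Qed.

Lemma line_through0 z y : line_through z y 0 = z.
Proof. by apply/funext => i; rewrite /line_through line_path0. Qed.

Lemma line_through_near0 z y : open_unit_cube z ->
  \forall t \near nbhs (0 : R), open_unit_cube (line_through z y t).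
Proof.
move=> z01; apply: filter_forall => i; have /andP[z0 z1] := z01 i.
have line_cvg : line_through z y t i @[t --> 0] --> z i.
  rewrite -[X in _ --> X](line_path0 (z i) (y i)).
  exact: continuous_line_path.
near=> t; apply/andP; split; near: t.
- exact: cvgr_gt line_cvg _ z0.
- exact: cvgr_lt line_cvg _ z1.
Unshelve. all: by end_near. Qed.

Lemma max_entropy_stationary A z y : affine_set A -> max_entropy_point A z ->
  open_unit_cube z -> A y -> \sum_i (y i - z i) * log_odds (z i) = 0.
Proof.
move=> affA zmax z01 Ay.
have /nbhs_ballP[e /= e0 ball01] := line_through_near0 y z01.
have zy01 (t : R) : t \in `]-e, e[ -> open_unit_cube (line_through z y t).
  rewrite in_itv /= -ltr_norml => te.
  by apply: ball01; rewrite -ball_normE /= sub0r normrN.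
have e0_in : 0 \in `]-e, e[ by rewrite in_itv /= oppr_lt0 e0.
have [_ slope0] : is_derive (0 : R) 1 (family_entropy \o line_through z y) 0.
  apply: derive1_at_max e0_in _ => [|t /zy01 t01|t /zy01 t01].
  - by rewrite ge0_cp // ltW.
  - by have [] := is_derive_family_entropy_line t01.
  - by rewrite /= line_through0; exact: (max_entropy_line_le affA).
have [_] := is_derive_family_entropy_line (zy01 0 e0_in).
by rewrite slope0 line_through0 => /esym/eqP; rewrite oppr_eq0 => /eqP.
Qed.

Lemma max_entropy_cross_entropy A z x : affine_set A -> max_entropy_point A z ->
  open_unit_cube z -> A x -> cross_entropy x z = family_entropy z.
Proof.
move=> affA zmax z01 Ax.
by rewrite cross_entropyE (max_entropy_stationary affA zmax z01 Ax) subr0.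
Qed.

End MaximumEntropy.

Section IndependentBernoulli.
Context {d : measure_display} {T : measurableType d} {R : realType}.
Context {P : probability T R} {I : finType} (X : I -> {RV P >-> R}).
Implicit Types x z : I -> R.
Hypothesis X_indep : mutually_independent X.

Lemma independent_joint_pmf x :
  P [set w | forall i, X i w = x i] = (\prod_i P [set w | X i w = x i])%E.
Proof.
have := X_indep (J := [set: I]%SET) (fun i _ => measurable_set1 (x i)).
rewrite (eq_bigl xpredT) => [<-|i]; last by rewrite inE.
congr (P _); apply/seteqP; split=> w Xw i; first by move=> _; exact: Xw.
by apply: Xw; rewrite /= inE.
Qed.

Lemma bernoulli_joint_pmf z x :
    (forall i, P [set w | X i w = 1] = (z i)%:E) ->
    (forall i, P [set w | X i w = 0] = (1 - z i)%:E) ->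
    open_unit_cube z -> (forall i, x i = 0 \/ x i = 1) ->
  P [set w | forall i, X i w = x i] = (expR (- cross_entropy x z))%:E.
Proof.
move=> X1 X0 z01 x01.
rewrite independent_joint_pmf -sumrN expR_sum -prodEFin.
apply: eq_bigr => i _; have /andP[z0 z1] := z01 i.
by have [->|->] := x01 i;
  rewrite ?X0 ?X1 ?expRN_binary_cross_entropy0 ?expRN_binary_cross_entropy1.
Qed.

End IndependentBernoulli.

Section Matrices.
Context {R : realType} {m n : nat}.
Variables (r : 'I_m -> nat) (c : 'I_n -> nat).
Implicit Types X Y Z : 'M[R]_(m, n).

Definition entries X : 'I_m * 'I_n -> R := fun p => X p.1 p.2.

Lemma entropyE X : entropy X = family_entropy (entries X).
Proof.
rewrite /entropy pair_bigA; apply: eq_bigr => p _.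
by rewrite !div1r !ln_inv !mulrN -opprD.
Qed.

Lemma affine_set_margins : affine_set (entries @` margins r c).
Proof.
move=> _ _ t [X [Xr Xc] <-] [Y [Yr Yc] <-].
exists ((1 - t) *: X + t *: Y); last by apply/funext => p; rewrite /entries !mxE.
by split=> k; under eq_bigr do rewrite !mxE;
  rewrite big_split -!mulr_sumr /= ?Xr ?Yr ?Xc ?Yc -mulrDl subrK mul1r.
Qed.

Lemma max_entropy_point_entries Z : max_entropy_matrix r c Z ->
  max_entropy_point (entries @` margins r c) (entries Z).
Proof.
move=> [[Zm Z01] Zmax]; split; first by split; [exists Z|move=> p; exact: Z01].
move=> _ [[X Xm <-] X01]; rewrite -!entropyE.
by apply: Zmax; split=> // i j; exact: (X01 (i, j)).
Qed.

End Matrices.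

Lemma matrix_pmfE (d : measure_display) (T : measurableType d) (R : realType)
    (P : probability T R) (m n : nat) (X : 'I_m -> 'I_n -> {RV P >-> R})
    (D : 'M[R]_(m, n)) :
  matrix_pmf X D = P [set w | forall p, X p.1 p.2 w = entries D p].
Proof.
congr (P _); apply/seteqP; split=> w /= XD.
  by move=> p; rewrite -XD /entries mxE.
by apply/matrixP => i j; rewrite mxE (XD (i, j)).
Qed.

Theorem theorem1p5 (R : realType) (m n : nat) (r : 'I_m -> nat) (c : 'I_n -> nat)
    (hsum : (\sum_(i < m) r i = \sum_(j < n) c j)%N)
    (hr : forall i, (0 < r i < n)%N)
    (hc : forall j, (0 < c j < m)%N)
    (hint : exists2 Y : 'M[R]_(m, n), polytope r c Y & forall i j, 0 < Y i j < 1)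
    (Z : 'M[R]_(m, n)) (hZ : max_entropy_matrix r c Z)
    (d : measure_display) (T : measurableType d) (P : probability T R)
    (X : 'I_m -> 'I_n -> {RV P >-> R})
    (hindep : mutually_independent (fun ij : 'I_m * 'I_n => X ij.1 ij.2))
    (hX1 : forall i j, P [set w | X i j w = 1] = (Z i j)%:E)
    (hX0 : forall i j, P [set w | X i j w = 0] = (1 - Z i j)%:E) :
  (forall D D' : 'M[R]_(m, n), zero_one_matrices r c D -> zero_one_matrices r c D' ->
     matrix_pmf X D = matrix_pmf X D') /\
  (forall D : 'M[R]_(m, n), zero_one_matrices r c D ->
     matrix_pmf X D = (expR (- entropy Z))%:E).
Proof.
have Zmax := max_entropy_point_entries hZ.
have affA := @affine_set_margins R m n r c.
have Zint : open_unit_cube (entries Z).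
  have [Y [Ym _] Y01] := hint.
  by apply: (max_entropy_interior affA Zmax (imageP entries Ym)) => q; exact: Y01.
have pmfE D : zero_one_matrices r c D -> matrix_pmf X D = (expR (- entropy Z))%:E.
  move=> [Dm D01]; rewrite matrix_pmfE entropyE.
  rewrite -(max_entropy_cross_entropy affA Zmax Zint (imageP entries Dm)).
  by apply: bernoulli_joint_pmf => // p; exact: D01.
by split=> // D D' /pmfE -> /pmfE ->.
Qed.
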